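(* For every finitely generated infinite group $Q$, there exists a finitely generated group $G$ such that $FSym(\mathbb N)\lhd G\le Sym(\mathbb N)$ and $G/FSym(\mathbb N)\cong Q$. In particular, $G$ is highly transitive.
   Context: $Sym(\mathbb N)$ is the group of all permutations of the countably infinite set $\mathbb N$, and $FSym(\mathbb N)$ is its subgroup of finitary permutations (those moving only finitely many points). An action of a group $G$ on a set $\Omega$ is $k$-transitive if $|\Omega|\ge k$ and for any two $k$-tuples of distinct elements $(a_1,\dots,a_k)$, $(b_1,\dots,b_k)$ of $\Omega$ there is $g\in G$ with $ga_i=b_i$ for all $i$; it is highly transitive if it is $k$-transitive for all $k\in\mathbb N$. A group is highly transitive if it admits a highly transitive faithful action. *)

(* Defs.v *)
From HB Require Import structures.
From mathcomp Require Import all_boot.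
From mathcomp Require Import mathcomp_extra boolp classical_sets functions.
From mathcomp Require Import cardinality.

Set Implicit Arguments.
Unset Strict Implicit.
Unset Printing Implicit Defensive.

Local Open Scope classical_set_scope.
Local Open Scope card_scope.
Local Open Scope group_scope.

(* [groupClosed gT] is used as the type of subgroups of [gT]; [subg G] is the
   subgroup [G] seen as a group in its own right. *)
Definition subg (gT : groupType) (G : groupClosed gT) : Type :=
  {x : gT | x \in G}.

Section Subg.
Variables (gT : groupType) (G : groupClosed gT).

HB.instance Definition _ := SubChoice.on (subg G).

Fact subg_closed : group_closed (fun x : gT => x \in G).
Proof.
by split; [exact: gpred1 | move=> x y xG yG; apply: (gpredF (S := G))].
Qed.

HB.instance Definition _ :=
  SubChoice_isSubGroup.Build gT (fun x : gT => x \in G) (subg G) subg_closed.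

End Subg.

Definition generated (gT : groupType) (S : set gT) : set gT :=
  \bigcap_(H in [set H : groupClosed gT | S `<=` [set` H]]) [set` H].

Definition finitely_generated (gT : groupType) : Prop :=
  exists S : set gT, finite_set S /\ generated S = [set: gT].

Definition infinite_group (gT : groupType) : Prop := infinite_set [set: gT].

Definition isomorphic (gT hT : groupType) : Prop :=
  exists f : {multiplicative gT -> hT}, bijective f.

Definition normal_in (gT : groupType) (N G : groupClosed gT) : Prop :=
  {subset N <= G} /\ {in N & G, forall n g, g * n * g^-1 \in N}.

Definition left_coset (gT : groupType) (N : groupClosed gT) (g : gT) : set gT :=
  [set g * n | n in [set` N]].

(* The group operations on the quotient are the elementwise operations on
   cosets; normality is what makes the set of cosets closed under them. *)
Definition quotient (gT : groupType) (G N : groupClosed gT)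
    (nNG : normal_in N G) : Type :=
  [set left_coset N g | g in [set` G]].

Section Quotient.
Variables (gT : groupType) (G N : groupClosed gT) (nNG : normal_in N G).
Local Notation Q := (quotient nNG).

HB.instance Definition _ := SubChoice.on Q.

Definition cosets_mul (A B : set gT) : set gT := [set a * b | a in A & b in B].
Definition cosets_inv (A : set gT) : set gT := [set a^-1 | a in A].

Lemma left_coset_mul g h : h \in G ->
  cosets_mul (left_coset N g) (left_coset N h) = left_coset N (g * h).
Proof.
move=> hG; apply/seteqP; split => x /=.
- case=> _ [n /= nN <-] [_ [m /= mN <-] <-].
  exists (h^-1 * n * h * m) => /=; last first.
    by rewrite !mulgA mulgK.
  apply: gpredM => //.
  have := nNG.2 n h^-1 nN; rewrite invgK; apply; exact/gpredVr.
- case=> n /= nN <-; exists g; first by exists 1; rewrite /= ?gpred1 ?mulg1.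
  by exists (h * n); [exists n | rewrite mulgA].
Qed.

Lemma left_coset_inv g : g \in G ->
  cosets_inv (left_coset N g) = left_coset N g^-1.
Proof.
move=> gG; apply/seteqP; split => x /=.
- case=> _ [n /= nN <-] <-; exists (g * n^-1 * g^-1) => /=.
    by apply: nNG.2 => //; apply/gpredVr.
  by rewrite !mulgA mulVg mul1g invgM.
- case=> n /= nN <-; exists (n^-1 * g); last by rewrite invgM invgK.
  exists (g^-1 * n^-1 * g); last by rewrite !mulgA mulgV mul1g.
  have := nNG.2 n^-1 g^-1; rewrite invgK /=; apply; exact/gpredVr.
Qed.

Definition in_quotient (g : gT) (gG : g \in G) : Q :=
  exist _ (left_coset N g) (mem_set (ex_intro2 _ _ g gG erefl)).

Lemma quotientP (A : Q) : exists g (gG : g \in G), A = in_quotient gG.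
Proof.
case: A => A AP; have [g gG gA] := set_mem AP.
by exists g, gG; apply: val_inj; rewrite /= -gA.
Qed.

Fact quotient_mul_subproof (A B : Q) :
  cosets_mul (val A) (val B) \in [set left_coset N g | g in [set` G]].
Proof.
have [g [gG ->]] := quotientP A; have [h [hG ->]] := quotientP B.
by rewrite /= left_coset_mul//; apply/mem_set; exists (g * h) => //=;
   apply: gpredM.
Qed.

Fact quotient_inv_subproof (A : Q) :
  cosets_inv (val A) \in [set left_coset N g | g in [set` G]].
Proof.
have [g [gG ->]] := quotientP A.
by rewrite /= left_coset_inv//; apply/mem_set; exists g^-1 => //=;
   apply: gpredVr.
Qed.

Definition quotient_one : Q := in_quotient (gpred1 (s := G)).
Definition quotient_mul (A B : Q) : Q := 
  exist _ (cosets_mul (val A) (val B)) (quotient_mul_subproof A B).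
Definition quotient_inv (A : Q) : Q := 
  exist _ (cosets_inv (val A)) (quotient_inv_subproof A).

Fact quotient_mulA : associative quotient_mul.
Proof.
move=> A B C; have [a [aG ->]] := quotientP A.
have [b [bG ->]] := quotientP B; have [c [cG ->]] := quotientP C.
apply: val_inj; rewrite /= !left_coset_mul ?mulgA//.
exact: gpredM.
Qed.

Fact quotient_mul1 : left_id quotient_one quotient_mul.
Proof.
move=> A; have [a [aG ->]] := quotientP A.
by apply: val_inj; rewrite /= left_coset_mul ?mul1g.
Qed.

Fact quotient_1mul : right_id quotient_one quotient_mul.
Proof.
move=> A; have [a [aG ->]] := quotientP A.
by apply: val_inj; rewrite /= left_coset_mul ?mulg1 ?gpred1.
Qed.

Fact quotient_mulV : left_inverse quotient_one quotient_inv quotient_mul.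
Proof.
move=> A; have [a [aG ->]] := quotientP A.
by apply: val_inj; rewrite /= left_coset_inv// left_coset_mul ?mulVg.
Qed.

Fact quotient_Vmul : right_inverse quotient_one quotient_inv quotient_mul.
Proof.
move=> A; have [a [aG ->]] := quotientP A.
apply: val_inj; rewrite /= left_coset_inv// left_coset_mul ?mulgV//.
exact: gpredVr.
Qed.

HB.instance Definition _ := isGroup.Build Q
  quotient_mulA quotient_mul1 quotient_1mul quotient_mulV quotient_Vmul.

End Quotient.

(* The product of permutations is composition, [(s * t) x = s (t x)]. *)
Definition Sym (T : choiceType) : Type := [set f : T -> T | bijective f].

Section Sym.
Variable T : choiceType.

HB.instance Definition _ := SubChoice.on (Sym T).

Definition sym_fun (s : Sym T) : T -> T := val s.
Coercion sym_fun : Sym >-> Funclass.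

Lemma sym_bij (s : Sym T) : bijective s.
Proof. exact: set_mem (valP s). Qed.

Lemma symP (s t : Sym T) : s =1 t -> s = t.
Proof. by move=> st; apply: val_inj; apply: funext. Qed.

Definition sym_of (f : T -> T) (fbij : bijective f) : Sym T :=
  exist _ f (mem_set fbij).

Fact sym_inv_subproof (s : Sym T) : {g : T -> T | cancel s g /\ cancel g s}.
Proof. by apply: cid; have [g sK gK] := sym_bij s; exists g. Qed.

Definition sym_one : Sym T := sym_of (inv_bij (fun=> erefl) : bijective id).
Definition sym_mul (s t : Sym T) : Sym T :=
  sym_of (bij_comp (sym_bij s) (sym_bij t)).
Definition sym_inv (s : Sym T) : Sym T :=
  let: exist g (conj sK gK) := sym_inv_subproof s in sym_of (Bijective gK sK).

Fact sym_mulA : associative sym_mul.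
Proof. by move=> s t u; apply: symP. Qed.

Fact sym_mul1 : left_id sym_one sym_mul.
Proof. by move=> s; apply: symP. Qed.

Fact sym_1mul : right_id sym_one sym_mul.
Proof. by move=> s; apply: symP. Qed.

Fact sym_mulV : left_inverse sym_one sym_inv sym_mul.
Proof.
by move=> s; apply: symP => x; rewrite /sym_inv;
   case: sym_inv_subproof => g [sK gK]; exact: sK.
Qed.

Fact sym_Vmul : right_inverse sym_one sym_inv sym_mul.
Proof.
by move=> s; apply: symP => x; rewrite /sym_inv;
   case: sym_inv_subproof => g [sK gK]; exact: gK.
Qed.

HB.instance Definition _ := isGroup.Build (Sym T)
  sym_mulA sym_mul1 sym_1mul sym_mulV sym_Vmul.

Definition FSym : {pred Sym T} :=
  fun s => `[< finite_set [set x | s x <> x] >].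

Fact FSym_mulg_closed : mulg_closed FSym.
Proof.
move=> s t /asboolP fs /asboolP ft; apply/asboolP.
have fU : finite_set 
    ([set x | (s : Sym T) x <> x] `|` [set x | (t : Sym T) x <> x]).
  by rewrite finite_setU.
apply: sub_finite_set fU => x /= stx; apply: contrapT => /not_orP[/contrapT sx /contrapT tx].
by apply: stx; rewrite -[LHS]/((s : Sym T) ((t : Sym T) x)) tx.
Qed.

Fact FSym_1 : 1 \in FSym.
Proof.
apply/asboolP; rewrite (_ : [set x | _] = set0); first exact: finite_set0.
by apply/seteqP; split.
Qed.

Fact FSym_invg_closed : invg_closed FSym.
Proof.
move=> s /asboolP fs; apply/asboolP; apply: sub_finite_set fs => x /= sVx sx.
by apply: sVx; rewrite -[in LHS]sx -[LHS]/((s^-1 * s : Sym T) x) mulVg.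
Qed.

HB.instance Definition _ := isMulClosed.Build (Sym T) FSym FSym_mulg_closed.
HB.instance Definition _ := isMul1Closed.Build (Sym T) FSym FSym_1.
HB.instance Definition _ := isInvClosed.Build (Sym T) FSym FSym_invg_closed.

End Sym.
Arguments FSym : clear implicits.

Record action (gT : groupType) (Omega : Type) := Action {
  act :> gT -> Omega -> Omega;
  act1 : forall x, act 1 x = x;
  actM : forall g h x, act (g * h) x = act g (act h x)
}.

Definition faithful (gT : groupType) (Omega : Type) (to : action gT Omega) :=
  forall g, (forall x, to g x = x) -> g = 1.

Definition k_transitive (k : nat) (gT : groupType) (Omega : Type)
    (to : action gT Omega) : Prop :=
  `I_k #<= [set: Omega] /\
  forall a b : 'I_k -> Omega, injective a -> injective b ->
    exists g, forall i, to g (a i) = b i.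

Definition highly_transitive_action (gT : groupType) (Omega : Type)
    (to : action gT Omega) : Prop :=
  forall k, k_transitive k to.

Definition highly_transitive (gT : groupType) : Prop :=
  exists (Omega : Type) (to : action gT Omega),
    faithful to /\ highly_transitive_action to.

(* Main.v *)
Require Import Defs.
From mathcomp Require Import all_boot.
From HB Require Import structures.
From mathcomp Require Import boolp classical_sets functions cardinality.

(** The group [Q] acts on itself by left translations, and a nontrivial
element moves every point, hence infinitely many of them.  A finitely
generated group is countable, so the infinite group [Q] can be identified with
the set of natural numbers, and its left translations become a copy of [Q]
inside [Sym nat] that meets [FSym nat] trivially.  As [FSym nat] is normal in
[Sym nat], the product [G] of these two subgroups is a semidirect product, and
[G] modulo [FSym nat] is [Q] ([isomorphic_quotient_complement]).

For the finite generation of [G], let [S] be a finite generating set of [Q].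
The translations by the elements of [S], together with the transpositions
exchanging [1] with an element of [S], generate [G]: conjugating the
transposition of [a] and [b] by the translation by [q] gives the transposition
of [q a] and [q b], so that one obtains the transpositions along all the edges
of the Cayley graph of [Q] with respect to [S].  This graph is connected, so
all transpositions are obtained ([transp_translation_subgroup]), and these
generate [FSym nat] ([FSym_sub_transp]).

Finally [G] is highly transitive on [nat] because [FSym nat] already is
([FSym_transitive]). *)

Set Implicit Arguments.
Unset Strict Implicit.
Unset Printing Implicit Defensive.

Local Open Scope classical_set_scope.
Local Open Scope card_scope.
Local Open Scope group_scope.

(** * Subgroups and generation *)

(** Supplies bundled subgroups without naming a boolean predicate: all the
subgroups below are given by propositions. *)
Lemma subgroup_of_set (gT : groupType) (A : set gT) :
  A 1 -> (forall x y, A x -> A y -> A (x * y)) -> (forall x, A x -> A x^-1) ->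
  exists H : groupClosed gT, forall x, x \in H <-> A x.
Proof.
move=> A1 AM AV; pose P : {pred gT} := fun x => `[< A x >].
have PE x : x \in P <-> A x by split=> /asboolP.
have PM : mulg_closed P by move=> x y /PE Ax /PE Ay; apply/PE/AM.
have P1 : 1 \in P by apply/PE.
have PV : invg_closed P by move=> x /PE Ax; apply/PE/AV.
pose H : groupClosed gT := HB.pack P (isMulClosed.Build gT P PM)
  (isMul1Closed.Build gT P P1) (isInvClosed.Build gT P PV).
by exists H.
Qed.

Lemma generated_ind (gT : groupType) (S A : set gT) :
  generated S = [set: gT] -> S `<=` A ->
  A 1 -> (forall x y, A x -> A y -> A (x * y)) -> (forall x, A x -> A x^-1) ->
  forall x, A x.
Proof.
move=> genS SA A1 AM AV x; have [H HA] := subgroup_of_set A1 AM AV.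
have: generated S x by rewrite genS.
by move=> /(_ H) Hx; apply/HA/Hx => y /SA /HA.
Qed.

(** Allows the generators of [subg G] to be handled as elements of the ambient
group: a subgroup of [subg G] is replaced by its image in [gT]. *)
Lemma finitely_generated_subg (gT : groupType) (G : groupClosed gT)
    (S : set gT) :
  finite_set S -> S `<=` [set` G] ->
  (forall H : groupClosed gT, S `<=` [set` H] -> [set` G] `<=` [set` H]) ->
  finitely_generated (subg G).
Proof.
move=> finS SG genS; exists [set x : subg G | S (val x)]; split.
  by apply: finite_preimage finS => x y _ _; apply: val_inj.
apply/seteqP; split=> // x _ H /= SH.
have [|_ _ [a [aH ->]] [b [bH ->]]|_ [a [aH ->]]|K KE] :=
    @subgroup_of_set gT [set y | exists a : subg G, a \in H /\ y = val a].
- by exists 1; split; first exact: gpred1.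
- by exists (a * b); split; first exact: gpredM.
- by exists a^-1; split; first exact: gpredVr.
have /KE[a [aH /val_inj ->//]] : val x \in K.
apply: (genS K); last exact: (valP x).
move=> y Sy; apply/KE; exists (exist _ y (SG y Sy) : subg G); split=> //.
exact: SH.
Qed.

(** The elements are the values of words over a countable alphabet. *)
Lemma finitely_generated_countable (gT : groupType) :
  finitely_generated gT -> countable [set: gT].
Proof.
move=> [S [/finite_seqP[s SE] genS]].
(* The flag makes the inverse of a letter a letter, so that the values of the
     words form a subgroup. *)
pose letter (l : bool * nat) : gT :=
  if l.1 then (nth 1 s l.2)^-1 else nth 1 s l.2.
pose word (w : seq (bool * nat)) : gT := foldr (fun l x => letter l * x) 1 w.
have wordM u v : word (u ++ v) = word u * word v.
  by elim: u => [|l u IH] /=; rewrite ?mul1g// IH mulgA.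
have wordV w : exists v, word v = (word w)^-1.
  elim: w => [|[b i] w [v vE]]; first by exists [::]; rewrite /= invg1.
  exists (v ++ [:: (~~ b, i)]); rewrite wordM vE /= mulg1 invgM; congr (_ * _).
  by rewrite /letter /=; case: b => //=; rewrite invgK.
have wordT x : exists w, word w = x.
  move: x; apply: (generated_ind genS).
  - move=> x; rewrite SE /= => xs; exists [:: (false, index x s)].
    by rewrite /= mulg1 /letter /= nth_index.
  - by exists [::].
  - by move=> _ _ [u <-] [v <-]; exists (u ++ v).
  - by move=> _ [w <-]; apply: wordV.
have -> : [set: gT] = word @` setT.
  by apply/seteqP; split=> // x _; have [w <-] := wordT x; exists w.
by apply: sub_countable (card_image_le _ _) _.
Qed.

Lemma infinite_group_enum (gT : groupType) :
  finitely_generated gT -> infinite_group gT ->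
  exists e : gT -> nat, bijective e.
Proof.
move=> /finitely_generated_countable cnt inf.
have /card_set_bijP[e eb] := eq_card_nat cnt inf.
by exists e; rewrite -setTT_bijective.
Qed.

(** * Quotients with a complement *)

Lemma eq_left_coset (gT : groupType) (N : groupClosed gT) (g h : gT) :
  left_coset N g = left_coset N h <-> g^-1 * h \in N.
Proof.
split=> [gh|ghN].
  have : left_coset N h h by exists 1; rewrite /= ?gpred1 ?mulg1.
  by rewrite -gh => -[n /= nN <-]; rewrite mulKg.
apply/seteqP; split=> _ [n /= nN <-].
  exists (h^-1 * g * n); last by rewrite !mulgA mulgV mul1g.
  apply: gpredM => //; have := gpredVr _ ghN.
  by rewrite invgM invgK.
by exists (g^-1 * h * n); [exact: gpredM | rewrite !mulgA mulgV mul1g].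
Qed.

Lemma isomorphic_sym (gT hT : groupType) :
  isomorphic gT hT -> isomorphic hT gT.
Proof.
move=> [f [g fK gK]].
have gM : {morph g : x y / x * y}.
  by move=> x y; apply: (can_inj fK); rewrite gmulfM !gK.
pose g' : {multiplicative hT -> gT} :=
  HB.pack g (isMultiplicative.Build hT gT g gM).
by exists g'; exists f.
Qed.

Section Complement.
Variables (gT qT : groupType) (G N : groupClosed gT) (nNG : normal_in N G).
Variable L : qT -> gT.
Hypotheses (LM : {morph L : x y / x * y}) (LG : forall q, L q \in G).
Hypotheses (LN : forall q, L q \in N -> q = 1)
  (GL : forall g, g \in G -> exists q, (L q)^-1 * g \in N).

(** The inverse of the isomorphism sends [q] to the coset of [L q]; it is
injective because the image of [L] meets [N] trivially, and surjective because
[G] is the product of this image and [N]. *)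
Lemma isomorphic_quotient_complement : isomorphic (quotient nNG) qT.
Proof.
apply: isomorphic_sym.
pose f (q : qT) : quotient nNG := in_quotient nNG (LG q).
have fM : {morph f : x y / x * y}.
  by move=> x y; apply: val_inj; rewrite /= (left_coset_mul nNG)// LM.
have LV q : (L q)^-1 = L q^-1.
  have L1 : L 1 = 1.
    by apply: (can_inj (mulKg (L 1))); rewrite /= -LM !mulg1.
  by apply: (can_inj (mulKg (L q))); rewrite /= mulgV -LM mulgV L1.
pose f' : {multiplicative qT -> quotient nNG} :=
  HB.pack f (isMultiplicative.Build _ _ f fM).
exists f'; rewrite -setTT_bijective; split=> //.
- move=> x y _ _ /(congr1 val) /= /eq_left_coset.
  rewrite LV -LM => /LN xy1.
  by apply: (can_inj (mulKg x^-1)); rewrite /= xy1 mulVg.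
- move=> A _; have [g [gG ->]] := quotientP A; have [q qg] := GL gG.
  by exists q => //; apply: val_inj; apply/eq_left_coset.
Qed.

End Complement.

(** * Transpositions and finitary permutations *)

Section Transposition.
Variable T : choiceType.
Implicit Types (x y z : T) (s : Sym T).

Definition swap x y z : T := if z == x then y else if z == y then x else z.

Lemma swapK x y : involutive (swap x y).
Proof.
move=> z; rewrite /swap; have [->|zx] := eqVneq z x.
  by have [|] := eqVneq y x; rewrite ?eqxx.
by have [->|zy] := eqVneq z y; rewrite ?eqxx// (negbTE zx) (negbTE zy).
Qed.

Definition transp x y : Sym T := sym_of (inv_bij (swapK x y)).

Lemma transpE x y z : transp x y z = swap x y z. Proof. by []. Qed.

Lemma symM s (t : Sym T) z : (s * t : Sym T) z = s (t z). Proof. by []. Qed.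

Lemma symKV s z : s ((s^-1 : Sym T) z) = z.
Proof. by rewrite -symM mulgV. Qed.

Lemma sym_inj s : injective s.
Proof. exact: bij_inj (sym_bij s). Qed.

Lemma transpL x y : transp x y x = y.
Proof. by rewrite transpE /swap eqxx. Qed.

Lemma transp_fix x y z : z != x -> z != y -> transp x y z = z.
Proof. by rewrite transpE /swap => /negbTE-> /negbTE->. Qed.

Lemma transpxx x : transp x x = 1.
Proof. by apply: symP => z; rewrite transpE /swap; case: eqP => [->|]. Qed.

Lemma transpC x y : transp x y = transp y x.
Proof.
apply: symP => z; rewrite !transpE /swap.
by case: eqP => [->|//]; case: eqP.
Qed.

Lemma transpJ s x y : s * transp x y * s^-1 = transp (s x) (s y).
Proof.
apply: symP => z; rewrite !symM -{2}(symKV s z).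
move: ((s^-1 : Sym T) z) => {}z.
by rewrite !transpE /swap !(inj_eq (@sym_inj s)); do 2 case: eqP => // _.
Qed.

Lemma transp_FSym x y : transp x y \in FSym T.
Proof.
apply/asboolP; apply: (@sub_finite_set _ _ [set` [:: x; y]]).
  move=> z /= zN; rewrite !inE; apply: contra_notT zN.
  by rewrite negb_or => /andP[zx zy]; apply: transp_fix.
exact: finite_seq.
Qed.

(** For pairwise distinct points, the transposition of [x] and [z] is
conjugate, by the transposition of [x] and [y], to that of [y] and [z]. *)
Lemma transp_trans (H : groupClosed (Sym T)) x y z :
  transp x y \in H -> transp y z \in H -> transp x z \in H.
Proof.
move=> xyH yzH; have [<-//|zy] := eqVneq y z.
have [<-|xz] := eqVneq x z; first by rewrite transpxx gpred1.
have -> : transp x z = transp x y * transp y z * (transp x y)^-1.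
  rewrite transpJ (transpC x y) transpL [transp y x z]transp_fix//.
    by rewrite eq_sym.
  by rewrite eq_sym.
by apply: gpredM; [exact: gpredM | exact: gpredVr].
Qed.

Lemma FSym_normal s f : f \in FSym T -> s * f * s^-1 \in FSym T.
Proof.
move=> /asboolP finf; apply/asboolP.
apply: (sub_finite_set _ (finite_image s finf)).
move=> z /= zN; exists ((s^-1 : Sym T) z); last exact: symKV.
by move=> fz; apply: zN; rewrite !symM fz symKV.
Qed.

(** A finitary permutation taking [a i] to [b i] for [i < n] is corrected at
[n] by composing it with the transposition of its value at [a n] and [b n];
the previous values are distinct from both. *)
Lemma FSym_transitive k (a b : 'I_k -> T) : injective a -> injective b ->
  exists2 f, f \in FSym T & forall i, f (a i) = b i.
Proof.
move=> ai bi.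
suff: forall n, (n <= k)%N -> exists2 f, f \in FSym T &
    forall i : 'I_k, (i < n)%N -> f (a i) = b i.
  by case/(_ k (leqnn k)) => f fF fab; exists f => // i; apply: fab.
elim=> [|n IH] nk.
  by exists 1; [exact: gpred1 | move=> i; rewrite ltn0].
have [f fF fab] := IH (ltnW nk); pose j := Ordinal nk.
exists (transp (f (a j)) (b j) * f); first exact: gpredM (transp_FSym _ _) fF.
move=> i; rewrite ltnS leq_eqVlt symM => /predU1P[ij|lt_in].
  by have -> : i = j; [exact: val_inj | rewrite transpL].
have ij : i != j by rewrite -val_eqE /= neq_ltn lt_in.
rewrite transp_fix ?(fab i)//; last by rewrite (inj_eq bi).
by rewrite -(fab i)// (inj_eq (@sym_inj f)) (inj_eq ai).
Qed.

End Transposition.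

(** A permutation [s] fixing every point above [n] is brought to one fixing
every point from [n] on by the transposition of [n] and [s n]; as finitary
permutations of [nat] have bounded support, iterating this ends at [1]. *)
Lemma FSym_sub_transp (H : groupClosed (Sym nat)) :
  (forall x y, transp x y \in H) -> forall f, f \in FSym nat -> f \in H.
Proof.
move=> trH f /asboolP finf.
have [n fn] : exists n, forall x, (n <= x)%N -> f x = x.
  have /finite_seqP[s sE] := finf.
  exists (\max_(i <- s) i).+1 => x ltx; apply: contrapT => fx.
  have : x \in s by have : [set` s] x by rewrite -sE.
  by move=> xs; move: ltx; rewrite ltnNge (leq_bigmax_seq x).
elim: n f {finf} fn => [|n IH] f fn.
  by have -> : f = 1; [apply: symP => x; rewrite fn | exact: gpred1].
have : transp n (f n) * f \in H.
  apply: IH => x; rewrite leq_eqVlt symM => /predU1P[<-|nx].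
    by rewrite transpC transpL.
  have xn : x != n by rewrite neq_ltn nx orbT.
  rewrite (fn x nx) transp_fix//.
  by rewrite -[in X in X != _](fn x nx) (inj_eq (@sym_inj _ f)).
by rewrite gpredMl.
Qed.

(** * The translation group *)

Section Translation.
Variables (qT : groupType) (e : qT -> nat) (e' : nat -> qT).
Hypotheses (eK : cancel e e') (e'K : cancel e' e).

Lemma translation_bij q : bijective (fun n => e (q * e' n)).
Proof.
by exists (fun n => e (q^-1 * e' n)) => n; rewrite eK mulgA ?mulVg ?mulgV mul1g.
Qed.

Definition translation q : Sym nat := sym_of (translation_bij q).

Lemma translationE q n : translation q n = e (q * e' n). Proof. by []. Qed.

Lemma translationM : {morph translation : p q / p * q}.
Proof.
by move=> p q; apply: symP => n; rewrite symM !translationE eK mulgA.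
Qed.

Lemma translation1 : translation 1 = 1.
Proof. by apply: symP => n; rewrite translationE mul1g e'K. Qed.

Lemma translationV q : translation q^-1 = (translation q)^-1.
Proof.
apply: (can_inj (mulKg (translation q))).
by rewrite /= -translationM !mulgV translation1.
Qed.

(** A fixed point of the translation by [q] forces [q = 1], so a nontrivial
translation has infinite support. *)
Lemma translation_FSym q : translation q \in FSym nat -> q = 1.
Proof.
move=> /asboolP finq; apply: contrapT => q1; apply: infinite_nat.
apply: sub_finite_set finq => n _ /=; rewrite translationE => qn; apply: q1.
have := congr1 e' qn; rewrite eK => /(congr1 (fun x => x / e' n)).
by rewrite mulgK mulgV.
Qed.

(** The points reachable from [1] by transpositions in [H] form a subgroup of
[qT]: as [H] contains the translations, the set of transpositions in [H] is
invariant under them. *)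
Lemma transp_translation_subgroup (H : groupClosed (Sym nat)) (S : set qT) :
  generated S = [set: qT] ->
  (forall s, S s -> translation s \in H) ->
  (forall s, S s -> transp (e 1) (e s) \in H) ->
  (forall q, translation q \in H) /\ (forall x y, transp x y \in H).
Proof.
move=> genS trS tpS.
have trH q : translation q \in H.
  move: q; apply: (generated_ind genS) => //.
  - by rewrite translation1 gpred1.
  - by move=> p q pH qH; rewrite translationM gpredM.
  - by move=> q qH; rewrite translationV; apply: gpredVr.
split=> //.
have conjH q x y : transp (e x) (e y) \in H ->
    transp (e (q * x)) (e (q * y)) \in H.
  move=> xyH; have := transpJ (translation q) (e x) (e y).
  rewrite !translationE !eK => <-.
  by apply: gpredM; [exact: gpredM | exact: gpredVr].
have tp1 q : transp (e 1) (e q) \in H.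
  move: q; apply: (generated_ind genS) => //.
  - by rewrite transpxx gpred1.
  - move=> p q pH qH; apply: transp_trans pH _.
    by have := conjH p _ _ qH; rewrite mulg1.
  - by move=> q /(conjH q^-1); rewrite mulg1 mulVg transpC.
by move=> x y; have := conjH (e' x) _ _ (tp1 ((e' x)^-1 * e' y));
  rewrite mulg1 mulgA mulgV mul1g !e'K.
Qed.

End Translation.

Lemma highly_transitive_FSym (G : groupClosed (Sym nat)) :
  {subset FSym nat <= G} -> highly_transitive (subg G).
Proof.
move=> FG.
pose to : action (subg G) nat :=
  @Action (subg G) nat (fun g n => (val g : Sym nat) n)
    (fun=> erefl) (fun _ _ _ => erefl).
exists nat, to; split=> [g g1|k]; first by apply: val_inj; apply: symP.
split; first exact: countableP.
move=> a b /FSym_transitive/[apply] -[f /FG fG fab].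
by exists (exist _ f fG : subg G).
Qed.

Theorem proposition1p1 (Q : groupType) :
  finitely_generated Q -> infinite_group Q ->
  exists (G : groupClosed (Sym nat)) (nFG : normal_in (FSym nat) G),
    [/\ finitely_generated (subg G),
        isomorphic (quotient nFG) Q &
        highly_transitive (subg G)].
Proof.
move=> fgQ infQ; have [e [e' eK e'K]] := infinite_group_enum fgQ infQ.
pose L := translation eK e'K.
have [|g h [p pg] [q qh]|g [q qg]|G GE] :=
    @subgroup_of_set (Sym nat) [set g | exists q, (L q)^-1 * g \in FSym nat].
- by exists 1; rewrite /L translation1 mulVg gpred1.
- exists (p * q).
  have -> : (L (p * q))^-1 * (g * h) =
      (L q)^-1 * ((L p)^-1 * g) * (L q)^-1^-1 * ((L q)^-1 * h).
    by rewrite /L translationM invgM invgK -!mulgA mulVKg.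
  by apply: gpredM => //; apply: FSym_normal.
- exists q^-1.
  have -> : (L q^-1)^-1 * g^-1 = L q * ((L q)^-1 * g)^-1 * (L q)^-1.
    by rewrite /L translationV invgK invgM invgK -!mulgA mulgV mulg1.
  by apply: FSym_normal; apply: gpredVr.
have LG q : L q \in G by apply/GE; exists q; rewrite mulVg gpred1.
have FG : {subset FSym nat <= G}.
  by move=> f fF; apply/GE; exists 1; rewrite /L translation1 invg1 mul1g.
have nFG : normal_in (FSym nat) G.
  by split=> // f g fF _; apply: FSym_normal.
exists G, nFG; split; last exact: highly_transitive_FSym.
- have [S [finS genS]] := fgQ.
  apply: (@finitely_generated_subg _ _
      (L @` S `|` [set transp (e 1) (e s) | s in S])).
  + by rewrite finite_setU; split; apply: finite_image.
  + by move=> _ [[q _ <-]|[s _ <-]] /=; [exact: LG | exact/FG/transp_FSym].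
  + move=> H SH g /GE[q qg].
    have [|||LH tpH] := @transp_translation_subgroup _ _ _ eK e'K H S => //.
    * by move=> s Ss; apply: SH; left; exists s.
    * by move=> s Ss; apply: SH; right; exists s.
    rewrite /= -(mulVKg (L q) g); apply: gpredM; first exact: LH.
    exact: FSym_sub_transp.
- apply: (@isomorphic_quotient_complement _ _ _ _ _ L) => //.
  + exact: translationM.
  + exact: translation_FSym.
  + by move=> g /GE.
Qed.
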